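(* The bonded braid monoid $BB_n$ admits a (reduced) monoid presentation with generators the elementary braid generators $\sigma_i$ and their inverses $\sigma_i^{-1}$, $1\le i\le n-1$, and the uniform overpass bonds $b_{ij}$, $1\le i<j\le n$ (write $b_i=b_{i,i+1}$), with relations $\sigma_i\sigma_i^{-1}=\sigma_i^{-1}\sigma_i=1$ and: $$\begin{array}{lrcll} 1) & \sigma_i\sigma_j & = & \sigma_j\sigma_i & \text{for } |i-j|>1\\ 2) & \sigma_i\sigma_{i+1}\sigma_i & = & \sigma_{i+1}\sigma_i\sigma_{i+1} & \text{for } 1\le i\le n-2\\ 3) & b_{ij}b_{rs} & = & b_{rs}b_{ij} & \text{for } i<j<r<s \text{ or } i<r<s<j\\ 4) & \sigma_i^{-1}b_{i+1,j}\sigma_i & = & b_{ij} & \text{for } 1\le i,\ i+1<j\le n\\ 5) & \sigma_{j-1}b_{i,j-1}\sigma_{j-1}^{-1} & = & b_{ij} & \text{for } 1\le i<j-1,\ j\le n\\ 6) & \sigma_ib_i & = & b_i\sigma_i & \text{for } 1\le i\le n-1\\ 7) & \sigma_ib_{rs} & = & b_{rs}\sigma_i & \text{for } i\notin\{r-1,r,s-1,s\},\ 1\le r<s\le n\\ 8) & b_i\sigma_{i+1}\sigma_i & = & \sigma_{i+1}\sigma_ib_{i+1} & \text{for } 1\le i<n-1\\ 9) & \sigma_i\sigma_{i+1}b_i & = & b_{i+1}\sigma_i\sigma_{i+1} & \text{for } 1\le i<n-1. \end{array}$$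
   Context: The bonded braid monoid $BB_n$ is the monoid generated by $\sigma_i^{\pm1}$ ($1\le i\le n-1$) and the bonds $b_{ij}^{\mathcal I}$ for $1\le i<j\le n$ and $\mathcal I\subseteq\{i+1,\dots,j-1\}$ (the set of indices of the strands the bond passes under); write $b_{ij}=b_{ij}^{\emptyset}$ (uniform overpassing bond) and $b_i=b_{i,i+1}$. The defining relations are $\sigma_i\sigma_i^{-1}=\sigma_i^{-1}\sigma_i=1$ and: 1) $\sigma_i\sigma_j=\sigma_j\sigma_i$ for $|i-j|>1$. 2) $\sigma_i\sigma_{i+1}\sigma_i=\sigma_{i+1}\sigma_i\sigma_{i+1}$ for all $i$. 3) $b_{ij}^{\mathcal I}b_{rs}^{\mathcal R}=b_{rs}^{\mathcal R}b_{ij}^{\mathcal I}$ for $i<j<r<s$ and all $\mathcal I,\mathcal R$. 4) $b_{ij}^{\mathcal I}b_{rs}^{\mathcal R}=b_{rs}^{\mathcal R}b_{ij}^{\mathcal I}$ for $i<r<s<j$ whenever either $r,s\in\mathcal I$ and $\mathcal R\subseteq\mathcal I\cap\{r+1,\dots,s-1\}$, or $r,s\notin\mathcal I$ and $\mathcal I\cap\{r+1,\dots,s-1\}\subseteq\mathcal R$. 5.1) $\sigma_i^{-1}b_{i+1,j}^{\mathcal I}\sigma_i=b_{ij}^{\mathcal I}$ for $j-i>1$, $\mathcal I\subseteq\{i+2,\dots,j-1\}$. 5.2) $\sigma_i b_{i+1,j}^{\mathcal I}\sigma_i^{-1}=b_{ij}^{\{i+1\}\cup\mathcal I}$ for $j-i>1$,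 $\mathcal I\subseteq\{i+2,\dots,j-1\}$. 5.3) $\sigma_{j-1}b_{i,j-1}^{\mathcal I}\sigma_{j-1}^{-1}=b_{ij}^{\mathcal I}$ for $j-i>1$, $\mathcal I\subseteq\{i+1,\dots,j-2\}$. 5.4) $\sigma_{j-1}^{-1}b_{i,j-1}^{\mathcal I}\sigma_{j-1}=b_{ij}^{\mathcal I\cup\{j-1\}}$ for $j-i>1$, $\mathcal I\subseteq\{i+1,\dots,j-2\}$. 6) $\sigma_ib_i=b_i\sigma_i$ for $1\le i\le n-1$. 7) $\sigma_ib_{rs}^{\mathcal R}=b_{rs}^{\mathcal R}\sigma_i$ for $i+1<r$ or $i>s$. 8.1) $\sigma_ib_{rs}^{\mathcal R}=b_{rs}^{\mathcal R}\sigma_i$ for $r<i<s-1$ when $i,i+1\in\mathcal R$ or $i,i+1\notin\mathcal R$. 8.2) $\sigma_ib_{rs}^{\mathcal R}=b_{rs}^{\mathcal R'}\sigma_i$ for $r<i<s-1$, where $\mathcal R,\mathcal R'\subseteq\{r+1,\dots,s-1\}$ are equal except that $i\in\mathcal R$, $i+1\notin\mathcal R$, $i\notin\mathcal R'$, $i+1\in\mathcal R'$. 9.1) $b_i\sigma_{i+1}\sigma_i=\sigma_{i+1}\sigma_ib_{i+1}$ for $1\le i<n-1$. 9.2) $\sigma_i\sigma_{i+1}b_i=b_{i+1}\sigma_i\sigma_{i+1}$ for $1\le i<n-1$. (All strand indices in $\{1,\dots,n\}$.) *)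

(* Defs.v *)
From HB Require Import structures.
From mathcomp Require Import all_boot finmap boolp.
Set Implicit Arguments.
Unset Strict Implicit.
Unset Printing Implicit Defensive.

Import Algebra.
Local Open Scope group_scope.
Local Open Scope quotient_scope.

(* The two-sided congruence on the free monoid [seq X] generated by [rel]. *)
Inductive congruence (X : Type) (rel : seq X -> seq X -> Prop) :
    seq X -> seq X -> Prop :=
| cong_rel u v s t : rel u v -> congruence rel (s ++ u ++ t) (s ++ v ++ t)
| cong_refl u : congruence rel u u
| cong_sym u v : congruence rel u v -> congruence rel v u
| cong_trans u v w :
    congruence rel u v -> congruence rel v w -> congruence rel u w.

Lemma congruence_cat (X : Type) (rel : seq X -> seq X -> Prop) u u' v v' :
  congruence rel u u' -> congruence rel v v' ->
  congruence rel (u ++ v) (u' ++ v').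
Proof.
have ctx s t a b : congruence rel a b ->
    congruence rel (s ++ a ++ t) (s ++ b ++ t).
  elim=> {a b} [a b s' t' ab|a|a b _ ih|a b c _ ih1 _ ih2].
  - have := cong_rel (s ++ s') (t' ++ t) ab.
    by rewrite !catA -!catA.
  - exact: cong_refl.
  - exact: cong_sym.
  - exact: cong_trans ih1 ih2.
move=> uu' vv'; apply: (@cong_trans _ _ _ (u' ++ v)).
  exact: (ctx [::] v).
by have := ctx u' [::] _ _ vv'; rewrite !cats0.
Qed.

Section PresentedMonoid.
Context (X : choiceType) (rel : seq X -> seq X -> Prop).

Definition congb (u v : seq X) : bool := `[< congruence rel u v >].

Lemma congb_refl : reflexive congb.
Proof. by move=> u; apply/asboolP; exact: cong_refl. Qed.

Lemma congb_sym : symmetric congb.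
Proof. by move=> u v; apply/asboolP/asboolP; exact: cong_sym. Qed.

Lemma congb_trans : transitive congb.
Proof.
move=> v u w /asboolP uv /asboolP vw.
by apply/asboolP; exact: cong_trans uv vw.
Qed.

Canonical congb_equiv := EquivRel congb congb_refl congb_sym congb_trans.

Definition presented_monoid : Type := {eq_quot congb}.

HB.instance Definition _ := Choice.on presented_monoid.

Definition word_class (u : seq X) : presented_monoid :=
  \pi_({eq_quot congb}) u.

Lemma word_classP u v :
  word_class u = word_class v <-> congruence rel u v.
Proof. by split=> [/eqmodP/asboolP|uv]; last apply/eqmodP/asboolP. Qed.

Definition pm_mul (x y : presented_monoid) : presented_monoid :=
  word_class (repr (x : {eq_quot congb}) ++ repr (y : {eq_quot congb})).

Definition pm_one : presented_monoid := word_class [::].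

Lemma word_class_surj (x : presented_monoid) : exists u, x = word_class u.
Proof.
by exists (repr (x : {eq_quot congb})); rewrite /word_class reprK.
Qed.

Lemma pm_mulE u v : pm_mul (word_class u) (word_class v) = word_class (u ++ v).
Proof.
apply/word_classP; apply: congruence_cat; apply/word_classP;
  by rewrite /word_class reprK.
Qed.

Lemma pm_mulA : associative pm_mul.
Proof.
move=> x y z; have [u ->] := word_class_surj x; have [v ->] := word_class_surj y.
by have [w ->] := word_class_surj z; rewrite !pm_mulE catA.
Qed.

Lemma pm_mul1 : left_id pm_one pm_mul.
Proof. by move=> x; have [u ->] := word_class_surj x; rewrite pm_mulE. Qed.

Lemma pm_mulr1 : right_id pm_one pm_mul.
Proof.
by move=> x; have [u ->] := word_class_surj x; rewrite pm_mulE cats0.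
Qed.

HB.instance Definition _ :=
  isMonoid.Build presented_monoid pm_mulA pm_mul1 pm_mulr1.

Definition pm_gen (x : X) : presented_monoid := word_class [:: x].

End PresentedMonoid.

Arguments word_class {X} rel u.
Arguments pm_gen {X} rel x.

(* [M] is presented by < X | rel >, the generator [x] being the element [gen x]
   of [M]. *)
Definition has_presentation (M : monoidType) (X : choiceType) (gen : X -> M)
    (rel : seq X -> seq X -> Prop) : Prop :=
  exists phi : UMagmaMorphism.type (presented_monoid rel) M,
    bijective phi /\ forall x, phi (pm_gen rel x) = gen x.

(* Strand indices are numbered from 1, so that [between i j] is the set
   {i+1, ..., j-1}. *)
Definition between (i j : nat) : {fset nat} :=
  [fset k in iota i.+1 (j - i.+1)]%fset.

Inductive letter :=
| Sigma of nat
| SigmaInv of nat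
| Bond of nat & nat & {fset nat}.

Definition letter_code (l : letter) : nat + nat + nat * nat * {fset nat} :=
  match l with
  | Sigma i => inl (inl i)
  | SigmaInv i => inl (inr i)
  | Bond i j B => inr (i, j, B)
  end.

Definition letter_decode (c : nat + nat + nat * nat * {fset nat}) : letter :=
  match c with
  | inl (inl i) => Sigma i
  | inl (inr i) => SigmaInv i
  | inr (i, j, B) => Bond i j B
  end.

Lemma letter_codeK : cancel letter_code letter_decode.
Proof. by case. Qed.

HB.instance Definition _ := Choice.copy letter (can_type letter_codeK).

Declare Scope bb_scope.
Delimit Scope bb_scope with BB.
Notation "'σ_[' i ]" := (Sigma i) (format "'σ_[' i ]") : bb_scope.
Notation "'σV_[' i ]" := (SigmaInv i) (format "'σV_[' i ]") : bb_scope.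
Notation "'b_[' i , j ; I ]" := (Bond i j I)
  (format "'b_[' i ,  j ;  I ]") : bb_scope.
Notation "'b_[' i , j ]" := (Bond i j fset0)
  (format "'b_[' i ,  j ]") : bb_scope.
Notation "'b_[' i ]" := (Bond i i.+1 fset0) (format "'b_[' i ]") : bb_scope.
Local Open Scope bb_scope.

Definition bb_letter (n : nat) (l : letter) : bool :=
  match l with
  | Sigma i | SigmaInv i => (1 <= i) && (i < n)
  | Bond i j B => [&& 1 <= i, i < j, j <= n & (B `<=` between i j)%fset]
  end.

Definition overpass (l : letter) : bool :=
  match l with
  | Bond _ _ B => B == fset0
  | _ => true
  end.

Definition reduced_letter (n : nat) (l : letter) : bool :=
  bb_letter n l && overpass l.

Definition bb_gen (n : nat) : choiceType := {l : letter | bb_letter n l}.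

Definition reduced_gen (n : nat) : choiceType :=
  {l : letter | reduced_letter n l}.

Lemma reduced_letter_bb n l : reduced_letter n l -> bb_letter n l.
Proof. by case/andP. Qed.

Definition reduced_to_bb n (x : reduced_gen n) : bb_gen n :=
  exist _ (val x) (reduced_letter_bb (valP x)).

(* The relations below are stated between words in unrestricted letters, and
   [on_gens] keeps the instances in which both sides are words in the generators
   of the n-strand monoid. This is what imposes the bounds 1 <= i <= n-1 on
   [σ_[i]] and 1 <= i < j <= n, I a subset of {i+1, ..., j-1}, on bonds. *)
Definition on_gens (P : pred letter) (rel : seq letter -> seq letter -> Prop)
    (u v : seq {l : letter | P l}) : Prop :=
  rel (map val u) (map val v).

Definition shifted (i : nat) (R R' : {fset nat}) : Prop :=
  [/\ i \in R, i.+1 \notin R, i \notin R', i.+1 \in R' &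
      forall k, k != i -> k != i.+1 -> (k \in R) = (k \in R')].

Inductive bb_rel : seq letter -> seq letter -> Prop :=
| bb_sigmaV i : bb_rel [:: σ_[i]; σV_[i]] [::]
| bb_Vsigma i : bb_rel [:: σV_[i]; σ_[i]] [::]
| bb_1 i j : (i.+1 < j) || (j.+1 < i) ->
    bb_rel [:: σ_[i]; σ_[j]] [:: σ_[j]; σ_[i]]
| bb_2 i :
    bb_rel [:: σ_[i]; σ_[i.+1]; σ_[i]] [:: σ_[i.+1]; σ_[i]; σ_[i.+1]]
| bb_3 i j r s (I R : {fset nat}) : i < j -> j < r -> r < s ->
    bb_rel [:: b_[i, j; I]; b_[r, s; R]] [:: b_[r, s; R]; b_[i, j; I]]
| bb_4 i j r s (I R : {fset nat}) : i < r -> r < s -> s < j ->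
    [/\ r \in I, s \in I & (R `<=` I `&` between r s)%fset] \/
    [/\ r \notin I, s \notin I & (I `&` between r s `<=` R)%fset] ->
    bb_rel [:: b_[i, j; I]; b_[r, s; R]] [:: b_[r, s; R]; b_[i, j; I]]
| bb_5_1 i j (I : {fset nat}) : i.+1 < j -> (I `<=` between i.+1 j)%fset ->
    bb_rel [:: σV_[i]; b_[i.+1, j; I]; σ_[i]] [:: b_[i, j; I]]
| bb_5_2 i j (I : {fset nat}) : i.+1 < j -> (I `<=` between i.+1 j)%fset ->
    bb_rel [:: σ_[i]; b_[i.+1, j; I]; σV_[i]] [:: b_[i, j; (i.+1 |` I)%fset]]
| bb_5_3 i j (I : {fset nat}) : i.+1 < j -> (I `<=` between i j.-1)%fset ->
    bb_rel [:: σ_[j.-1]; b_[i, j.-1; I]; σV_[j.-1]] [:: b_[i, j; I]]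
| bb_5_4 i j (I : {fset nat}) : i.+1 < j -> (I `<=` between i j.-1)%fset ->
    bb_rel [:: σV_[j.-1]; b_[i, j.-1; I]; σ_[j.-1]]
           [:: b_[i, j; (j.-1 |` I)%fset]]
| bb_6 i : bb_rel [:: σ_[i]; b_[i]] [:: b_[i]; σ_[i]]
| bb_7 i r s (R : {fset nat}) : (i.+1 < r) || (s < i) ->
    bb_rel [:: σ_[i]; b_[r, s; R]] [:: b_[r, s; R]; σ_[i]]
| bb_8_1 i r s (R : {fset nat}) : r < i -> i < s.-1 ->
    (i \in R /\ i.+1 \in R) \/ (i \notin R /\ i.+1 \notin R) ->
    bb_rel [:: σ_[i]; b_[r, s; R]] [:: b_[r, s; R]; σ_[i]]
| bb_8_2 i r s (R R' : {fset nat}) : r < i -> i < s.-1 -> shifted i R R' ->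
    bb_rel [:: σ_[i]; b_[r, s; R]] [:: b_[r, s; R']; σ_[i]]
| bb_9_1 i :
    bb_rel [:: b_[i]; σ_[i.+1]; σ_[i]] [:: σ_[i.+1]; σ_[i]; b_[i.+1]]
| bb_9_2 i :
    bb_rel [:: σ_[i]; σ_[i.+1]; b_[i]] [:: b_[i.+1]; σ_[i]; σ_[i.+1]].

Definition BB (n : nat) : monoidType :=
  presented_monoid (@on_gens (bb_letter n) bb_rel).

Inductive reduced_rel : seq letter -> seq letter -> Prop :=
| red_sigmaV i : reduced_rel [:: σ_[i]; σV_[i]] [::]
| red_Vsigma i : reduced_rel [:: σV_[i]; σ_[i]] [::]
| red_1 i j : (i.+1 < j) || (j.+1 < i) ->
    reduced_rel [:: σ_[i]; σ_[j]] [:: σ_[j]; σ_[i]]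
| red_2 i :
    reduced_rel [:: σ_[i]; σ_[i.+1]; σ_[i]] [:: σ_[i.+1]; σ_[i]; σ_[i.+1]]
| red_3 i j r s :
    [&& i < j, j < r & r < s] || [&& i < r, r < s & s < j] ->
    reduced_rel [:: b_[i, j]; b_[r, s]] [:: b_[r, s]; b_[i, j]]
| red_4 i j : i.+1 < j ->
    reduced_rel [:: σV_[i]; b_[i.+1, j]; σ_[i]] [:: b_[i, j]]
| red_5 i j : i < j.-1 ->
    reduced_rel [:: σ_[j.-1]; b_[i, j.-1]; σV_[j.-1]] [:: b_[i, j]]
| red_6 i : reduced_rel [:: σ_[i]; b_[i]] [:: b_[i]; σ_[i]]
| red_7 (i r s : nat) : i \notin [:: r.-1; r; s.-1; s] ->
    reduced_rel [:: σ_[i]; b_[r, s]] [:: b_[r, s]; σ_[i]]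
| red_8 i :
    reduced_rel [:: b_[i]; σ_[i.+1]; σ_[i]] [:: σ_[i.+1]; σ_[i]; b_[i.+1]]
| red_9 i :
    reduced_rel [:: σ_[i]; σ_[i.+1]; b_[i]] [:: b_[i.+1]; σ_[i]; σ_[i.+1]].

(* The element of [BB n] named by a generator of the reduced presentation. *)
Definition reduced_elt (n : nat) (x : reduced_gen n) : BB n :=
  pm_gen (@on_gens (bb_letter n) bb_rel) (reduced_to_bb x).

(* Main.v *)
(* In the monoid of the reduced presentation, define a general bond from the
   elementary bond [b_(j-1)] by conjugating successively with σ_(j-2)^±1, ...,
   σ_i^±1, the sign of σ_k recording whether the bond passes over or under the
   strand k+1. All relations of BB_n then follow from the braid relations and
   the reduced ones; the only delicate case is the commutation of nested bonds.
   Conjugating by the word of the inner bond makes the latter elementary, say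
   b_k, while the outer bond keeps the form of a bond; shortening the outer
   bond, which does not move b_k, leaves b_k and a bond from k-1 to k+2 that
   passes either over both or under both of the strands k and k+1. The first
   case is a reduced relation, and the second is conjugate to the first. *)
From HB Require Import structures.
From mathcomp Require Import all_boot finmap boolp zify.
Require Import Defs.
Set Implicit Arguments.
Unset Strict Implicit.
Unset Printing Implicit Defensive.

Import Algebra.
Local Open Scope group_scope.
Local Open Scope quotient_scope.
Local Open Scope bb_scope.

(** * Maps out of a presented monoid *)

Section PresentedMonoidMorphisms.
Context (X : choiceType) (rel : seq X -> seq X -> Prop).

Lemma word_class_prod u :
  word_class rel u = \prod_(x <- u) pm_gen rel x.
Proof.
elim: u => [|x u ih]; first by rewrite big_nil.
by rewrite big_cons -ih [RHS](pm_mulE rel [:: x] u).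
Qed.

Lemma presented_monoid_ext (M : monoidType)
    (phi psi : UMagmaMorphism.type (presented_monoid rel) M) :
  (forall x, phi (pm_gen rel x) = psi (pm_gen rel x)) -> phi =1 psi.
Proof.
move=> eq_gen x; have [u ->] := word_class_surj x.
by rewrite word_class_prod !gmulf_prod; apply: eq_bigr.
Qed.

Lemma presented_monoid_lift (M : monoidType) (g : X -> M) :
    (forall u v, rel u v -> \prod_(x <- u) g x = \prod_(x <- v) g x) ->
  exists phi : UMagmaMorphism.type (presented_monoid rel) M,
    forall x, phi (pm_gen rel x) = g x.
Proof.
move=> g_rel.
have g_cong u v : congruence rel u v ->
    \prod_(x <- u) g x = \prod_(x <- v) g x.
  elim=> {u v} [u v s t uv|//|u v _ ->//|u v w _ -> _ ->//].
  by rewrite !big_cat /= (g_rel _ _ uv).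
pose h (x : presented_monoid rel) : M :=
  \prod_(y <- repr (x : {eq_quot congb rel})) g y.
have hE u : h (word_class rel u) = \prod_(y <- u) g y.
  apply: g_cong; apply/word_classP.
  by rewrite /word_class reprK.
have h_morph : monoid_morphism h.
  split=> [|x y]; first by rewrite [h 1](hE [::]) big_nil.
  have [u ->] := word_class_surj x; have [v ->] := word_class_surj y.
  by rewrite [_ * _](pm_mulE rel u v) !hE big_cat.
pose H := isUMagmaMorphism.Build _ _ h h_morph.
pose phi : UMagmaMorphism.type _ _ := HB.pack h H.
by exists phi => x; rewrite /= hE big_seq1.
Qed.

End PresentedMonoidMorphisms.

Lemma inverse_unique (M : monoidType) (x x' y y' : M) :
  x * x' = 1 -> y' * y = 1 -> x = y -> x' = y'.
Proof.
by move=> xx' y'y xy; rewrite -[y']mulg1 -xx' mulgA xy y'y mul1g.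
Qed.

(** * Signed braid generators and conjugation by them *)

Section ReducedRelations.
Context (n : nat) (M : monoidType) (f : letter -> M).
Context (f_rel : forall u v, reduced_rel u v ->
  all (reduced_letter n) u -> all (reduced_letter n) v ->
  \prod_(l <- u) f l = \prod_(l <- v) f l).
(** With the value 1 on letters that are not generators, inverses and far commutations hold for all
    indices, without bounds. *)
Context (f_junk : forall l, ~~ reduced_letter n l -> f l = 1).

Lemma letter_commute l m :
  reduced_rel [:: l; m] [:: m; l] -> commute (f l) (f m).
Proof.
move=> /f_rel; rewrite /= !andbT !big_cons big_nil !mulg1.
have [lP|/f_junk-> _] := boolP (reduced_letter n l); last first.
  exact/commute_sym/commute1.
have [mP|/f_junk-> _] := boolP (reduced_letter n m); last exact: commute1.
exact.
Qed.

Definition sg (under : bool) (i : nat) : M :=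
  if under then f σV_[i] else f σ_[i].

Lemma sgV e i : sg e i * sg (~~ e) i = 1.
Proof.
rewrite /sg; have [iP|iNP] := boolP (reduced_letter n σ_[i]); last first.
  by case: e; rewrite !f_junk ?mulg1.
have iVP : reduced_letter n σV_[i] := iP.
case: e.
  by have /= := f_rel (red_Vsigma i); rewrite iP iVP !big_cons big_nil !mulg1 => ->.
by have /= := f_rel (red_sigmaV i); rewrite iP iVP !big_cons big_nil !mulg1 => ->.
Qed.

Lemma sgVr e i : sg (~~ e) i * sg e i = 1.
Proof. by rewrite -[X in _ * sg X i]negbK sgV. Qed.

(* [conj e i x] is x^σ_i for e = false and x^(σ_i^-1) for e = true. *)
Definition conj (e : bool) (i : nat) (x : M) : M := sg (~~ e) i * x * sg e i.

Lemma conjK e i : cancel (conj e i) (conj (~~ e) i).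
Proof.
move=> x; rewrite /conj negbK !mulgA sgV mul1g.
by rewrite -mulgA sgV mulg1.
Qed.

Lemma conjKV e i : cancel (conj (~~ e) i) (conj e i).
Proof. by rewrite -{2}[e]negbK; exact: conjK. Qed.

Lemma conj_eqP e i x y : conj e i x = y <-> x * sg e i = sg e i * y.
Proof.
split=> [<-|xy]; first by rewrite /conj !mulgA sgV mul1g.
by rewrite /conj -mulgA xy mulgA sgVr mul1g.
Qed.

Lemma conjM e i : {morph conj e i : x y / x * y}.
Proof.
move=> x y; rewrite /conj !mulgA -[sg (~~ e) i * x * sg e i * _]mulgA sgV.
by rewrite mulg1.
Qed.

Lemma conj_commute e i x y :
  commute (conj e i x) (conj e i y) <-> commute x y.
Proof.
split=> xy; last by rewrite /commute -!conjM xy.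
by apply: (can_inj (conjK e i)); rewrite !conjM.
Qed.

Lemma commute_sgV x e i : commute x (sg e i) -> commute x (sg (~~ e) i).
Proof.
move=> xe; rewrite /commute -[LHS]mul1g -(sgVr e i) -[LHS]mulgA.
by rewrite [sg e i * _]mulgA -xe -[x * _ * _]mulgA sgV mulg1.
Qed.

Lemma commute_sg x e e' i : commute x (sg e i) -> commute x (sg e' i).
Proof. by move=> xe; case: (eqVneq e' e) => [->//|]; case: e e' xe => -[]// /commute_sgV. Qed.

Lemma conj_id e i x : commute x (sg false i) -> conj e i x = x.
Proof. by move=> /(commute_sg e) xe; apply/conj_eqP. Qed.

Lemma sg_commute e e' i j : (i.+1 < j) || (j.+1 < i) ->
  commute (sg e i) (sg e' j).
Proof.
move=> ij; apply: (@commute_sg _ false); apply/commute_sym.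
apply: (@commute_sg _ false); apply/commute_sym.
exact/letter_commute/red_1.
Qed.

Lemma conjC e e' i j x : (i.+1 < j) || (j.+1 < i) ->
  conj e i (conj e' j x) = conj e' j (conj e i x).
Proof.
move=> ij; rewrite /conj !mulgA (sg_commute _ _ ij) -!mulgA.
by rewrite (sg_commute e e' ij).
Qed.

(** The sign condition excludes exactly a middle sign different from both outer ones. The admissible
    patterns with [b = false] are the braid relation itself or follow from it by cancelling an outer
    factor; the other three are their inverses. *)
Lemma sg_braid a b c i : 0 < i -> i.+1 < n -> (a == b) || (a != c) ->
  sg a i.+1 * sg b i * sg c i.+1 = sg c i * sg b i.+1 * sg a i.
Proof.
move=> i0 iltn.
have vP : reduced_letter n σ_[i] by rewrite /reduced_letter /= i0 ltnW.
have wP : reduced_letter n σ_[i.+1] by rewrite /reduced_letter /= iltn.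
have := f_rel (red_2 i); rewrite /= vP wP !big_cons big_nil !mulg1 !mulgA.
move=> /(_ isT isT); rewrite -/(sg false i) -/(sg false i.+1).
set x := sg false i; set y := sg false i.+1.
set x' := sg true i; set y' := sg true i.+1 => E.
have xx' : x * x' = 1 := sgV false i.
have x'x : x' * x = 1 := sgV true i.
have yy' : y * y' = 1 := sgV false i.+1.
have y'y : y' * y = 1 := sgV true i.+1.
have Eyxy' : y * x * y' = x' * y * x.
  have : x' * (x * y * x) * y' = x' * (y * x * y) * y' by rewrite E.
  rewrite !mulgA x'x mul1g => ->.
  by rewrite -(mulgA _ y y') yy' mulg1.
have Ey'xy : y' * x * y = x * y * x'.
  have : y' * (x * y * x) * x' = y' * (y * x * y) * x' by rewrite E.
  rewrite !mulgA y'y mul1g => <-.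
  by rewrite -(mulgA _ x x') xx' mulg1.
have inv3 (g g' h h' k k' : M) :
    g * g' = 1 -> h * h' = 1 -> k * k' = 1 -> g * h * k * (k' * h' * g') = 1.
  move=> gg hh kk; rewrite -!mulgA (mulgA k) kk mul1g (mulgA h) hh mul1g.
  exact: gg.
case: a b c => [] [] [] //= _.
- by apply: (inverse_unique _ _ (esym E)); apply: inv3.
- by apply: (inverse_unique _ _ Ey'xy); apply: inv3.
- by apply: (inverse_unique _ _ Eyxy'); apply: inv3.
Qed.

Lemma conj_braid a b c i x : 0 < i -> i.+1 < n -> (a == b) || (a != c) ->
  conj c i.+1 (conj b i (conj a i.+1 x)) =
  conj a i (conj b i.+1 (conj c i x)).
Proof.
move=> i0 iltn abc.
(* The factors to the left of [x] carry the negated signs in reverse order; the sign condition is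
   invariant under this change. *)
have cba : (~~ c == ~~ b) || (~~ c != ~~ a) by case: a b c abc => [] [] [].
have Ec := sg_braid i0 iltn cba; have Ea := sg_braid i0 iltn abc.
transitivity (sg (~~ c) i.+1 * sg (~~ b) i * sg (~~ a) i.+1 * x *
              (sg a i.+1 * sg b i * sg c i.+1)).
  by rewrite /conj !mulgA.
by rewrite Ea Ec /conj !mulgA.
Qed.

(** * General bonds as conjugates of elementary ones *)

Notation beta i := (f b_[i]).

(* [bond B d i] stands for b_(i,j)^I with j = i+d+1 and I = B ∩ {i+1,...,j-1}. *)
Fixpoint bond (B : pred nat) (d i : nat) : M :=
  if d is d'.+1 then conj (B i.+1) i (bond B d' i.+1) else beta i.

Lemma eq_bond (B C : pred nat) d i :
  (forall k, i < k <= i + d -> B k = C k) -> bond B d i = bond C d i.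
Proof.
elim: d i => //= d ih i BC; rewrite (BC i.+1) ?(ih i.+1) //; last by lia.
by move=> k ik; apply: BC; lia.
Qed.

Lemma conj_beta e k i : (k.+1 < i) || (i.+1 < k) || (k == i) ->
  conj e k (beta i) = beta i.
Proof.
move=> ki; apply: conj_id; apply: commute_sym; apply: letter_commute.
case/orP: ki => [ki|/eqP->]; last exact: red_6.
by apply: red_7; rewrite !inE; lia.
Qed.

Lemma conj_bond_far e k B d i : (k.+1 < i) || (i + d.+1 < k) ->
  conj e k (bond B d i) = bond B d i.
Proof.
elim: d i => [|d ih] i ki /=; first by apply: conj_beta; lia.
by rewrite conjC ?ih //; lia.
Qed.

(** The two signs are the relations [red_8] and [red_9], which let an elementary bond be lengthened
    at either end. *)
Lemma conj_beta_swap e i : 0 < i -> i.+1 < n ->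
  conj (~~ e) i.+1 (beta i) = conj e i (beta i.+1).
Proof.
move=> i0 iltn.
have vP : reduced_letter n σ_[i] by rewrite /reduced_letter /= i0 ltnW.
have wP : reduced_letter n σ_[i.+1] by rewrite /reduced_letter /= iltn.
have bP : reduced_letter n b_[i].
  by rewrite /reduced_letter /= eqxx fsub0set; lia.
have cP : reduced_letter n b_[i.+1].
  by rewrite /reduced_letter /= eqxx fsub0set; lia.
case: e; [have := f_rel (red_8 i) | have := f_rel (red_9 i)];
  rewrite /= vP wP bP cP !big_cons big_nil !mulg1 !mulgA => /(_ isT isT);
  rewrite -/(sg false i) -/(sg false i.+1) => E.
- by apply/conj_eqP; rewrite /conj !mulgA -E -mulgA sgV mulg1.
- by apply/esym/conj_eqP; rewrite /conj !mulgA E -mulgA sgV mulg1.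
Qed.

(** A bond built from its left end can also be extended at its right end: the new conjugator
    commutes with the others until only the innermost one is left, where [conj_beta_swap] reverses
    the sign. *)
Lemma conj_bond_right B d i : 0 < i -> i + d.+1 < n ->
  conj (~~ B (i + d.+1)) (i + d.+1) (bond B d i) = bond B d.+1 i.
Proof.
elim: d i => [|d ih] i i0 idn.
  by rewrite addn1 conj_beta_swap //; lia.
rewrite [bond B d.+1 i]/= conjC; last by lia.
by rewrite -addSnnS ih //; lia.
Qed.

(** The conjugation by σ_k moves inwards to the two conjugators recording the strands k and k+1.
    There [conj_braid] exchanges their signs and leaves a σ_(k-1), which is far from the rest of the
    bond. *)
Lemma conj_bond_swap e k (B C : pred nat) d i :
    0 < i -> i + d < n -> i < k -> k < i + d ->
    (B k == e) || (B k.+1 != e) ->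
    C k = B k.+1 -> C k.+1 = B k ->
    (forall m, m != k -> m != k.+1 -> C m = B m) ->
  conj e k (bond B d i) = bond C d i.
Proof.
move=> i0 idn ik kd Be Ck Ck1 Cm.
elim: d i i0 idn ik kd => [|d ih] i i0 idn ik kd; first by lia.
have [ltik|leki] := ltnP i.+1 k.
  rewrite /= conjC; last by lia.
  by rewrite ih ?Cm //; lia.
have {leki} kE : k = i.+1 by lia.
case: d ih idn kd => [|d] _ idn kd; first by lia.
subst k; rewrite /= conj_braid //; [|by lia|]; last first.
  by case: (B i.+1) (B i.+2) e Be => [] [] [].
rewrite conj_bond_far ?Ck ?Ck1; last by lia.
by rewrite (@eq_bond C B) // => m im; rewrite Cm //; lia.
Qed.

Lemma bond_overpass d i : 0 < i -> i + d < n ->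
  bond pred0 d i = f b_[i, i + d.+1].
Proof.
elim: d i => [|d ih] i i0 idn; first by rewrite addn1.
rewrite /= ih ?addSn //; last by lia.
have ltij : i.+1 < i + d.+2 by lia.
have := f_rel (red_4 ltij); rewrite /= !big_cons big_nil !mulg1 -addSnnS addSn.
rewrite /reduced_letter /= eqxx !fsub0set.
have ->: 0 < i = true by [].
have ->: i < n by lia.
move=> <-; rewrite /conj /sg /= ?mulgA //; lia.
Qed.

(** * Commutation of disjoint and of nested bonds *)

Lemma bond_far_commute B C d d' i r :
  i + d.+1 < r -> commute (bond B d i) (bond C d' r).
Proof.
elim: d' r => [|d' ih] r ir /=; last first.
  rewrite -(@conj_bond_far (C r.+1) r B d i) ?ir ?orbT //.
  by apply/conj_commute; apply: ih; lia.
elim: d i ir => [|d ih] i ir /=.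
  by apply: letter_commute; apply: red_3; lia.
rewrite -(@conj_beta (B i.+1) i r); last by lia.
by apply/conj_commute; apply: ih; lia.
Qed.

(* Conjugating by σ_(k+2) σ_k^-1 exchanges the two factors of this
   commutation while turning overpasses into underpasses. *)
Lemma beta_commute3 e k : 0 < k -> k.+2 < n ->
  commute (beta k.+1) (conj e k (conj e k.+1 (beta k.+2))).
Proof.
move=> k0 kn.
rewrite -conj_beta_swap //.
suff over : commute (beta k.+1) (conj false k (conj true k.+2 (beta k.+1))).
  case: e => //=; apply/(@conj_commute false k)/(@conj_commute true k.+2).
  by rewrite (conjKV false) (conjKV true) conjC ?ltnSn ?orbT //; apply/commute_sym.
have := @bond_overpass 2 k k0; rewrite /= -conj_beta_swap // => ->; last by lia.
by apply: commute_sym; apply: letter_commute; apply/red_3; lia.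
Qed.

(** The outer bond is stripped of its conjugators on the left, then on the right by
    [conj_bond_right]; all of them fix [beta k]. The remaining core spans k-1 to k+2 and is
    [beta_commute3]. *)
Lemma beta_bond_commute B k d i :
    0 < i -> i + d < n -> i < k -> k < i + d -> B k = B k.+1 ->
  commute (beta k) (bond B d i).
Proof.
move=> i0 idn ik kd Bk.
elim: d i i0 idn ik kd => [|d ih] i i0 idn ik kd; first by lia.
have [ltik|leki] := ltnP i.+1 k.
  rewrite /= -(@conj_beta (B i.+1) i k); last by lia.
  by apply/conj_commute; apply: ih; lia.
have {leki ih} kE : k = i.+1 by lia.
subst k; elim: d idn kd => [|d ih] idn kd; first by lia.
case: d ih idn kd => [|d] ih idn kd.
  by rewrite /= -Bk; apply: beta_commute3; lia.
rewrite -conj_bond_right //.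
rewrite -(@conj_beta (~~ B (i + d.+3)) (i + d.+3) i.+1); last by lia.
by apply/conj_commute; apply: ih; lia.
Qed.

(* Sliding the end of the inner bond from [r] to [s - 1] along its own
   conjugating word permutes the underpass set of the outer bond. *)
Lemma bond_nested_commute e (B C : pred nat) d d' i r :
    0 < i -> i + d < n -> i < r -> r + d' < i + d ->
    B r = e -> B (r + d'.+1) = e ->
    (forall k, r < k <= r + d' -> C k = e -> B k = e) ->
  commute (bond B d i) (bond C d' r).
Proof.
move=> i0 idn; elim: d' r B => [|d' ih] r B ir rd Br Bs CB /=.
  apply/commute_sym/beta_bond_commute => //; first by lia.
  by rewrite Br -Bs addn1.
pose q := C r.+1.
pose B' := fun k => if k == r then B r.+1 else if k == r.+1 then B r else B k.
have BB' : conj (~~ q) r (bond B d i) = bond B' d i.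
  apply: conj_bond_swap => //; rewrite /B' ?eqxx //; first by lia.
  (* Sign condition of the swap: if [q = e], then [CB] forces [B r.+1 = e]; otherwise [B r = e] is
     already [~~ q]. *)
  - have := CB r.+1; rewrite Br -/q.
    by case: (q) (e) (B r.+1) => [] [] [] // /(_ _ erefl) ->//; lia.
  - by rewrite gtn_eqF.
  - by move=> m /negPf-> /negPf->.
rewrite -[bond B d i](conjKV q r) BB' -/q.
apply/conj_commute/ih; rewrite /B'; try lia.
- by rewrite gtn_eqF ?eqxx.
- by rewrite !gtn_eqF; try lia; rewrite addSnnS.
- move=> k rk Ck; rewrite !gtn_eqF; try lia.
  by apply: CB => //; lia.
Qed.

(** * The relations of BB_n for the constructed bonds *)

Definition bond_eval (l : letter) : M :=
  if l is Bond i j B then bond (fun k => k \in B) (j - i.+1) i else f l.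

Lemma bond_evalE i d (B : {fset nat}) :
  bond_eval (Bond i (i + d.+1) B) = bond (fun k => k \in B) d i.
Proof. by rewrite /= addnS subSS addKn. Qed.

Lemma bond_eval_reduced l : reduced_letter n l -> bond_eval l = f l.
Proof.
case: l => // i j B /andP[/= /and4P[i0 ij jn _] /eqP->].
rewrite (@eq_bond _ pred0) => [|k _]; last by rewrite in_fset0.
by rewrite bond_overpass ?subnSK ?subnKC //; lia.
Qed.

Lemma in_between i j k : (k \in between i j) = (i < k < j).
Proof. by rewrite !inE /= mem_iota; lia. Qed.

Lemma notin_sub_between (B : {fset nat}) i j k :
  (B `<=` between i j)%fset -> ~~ (i < k < j) -> (k \in B) = false.
Proof.
move=> /fsubsetP sB; apply: contraNF => /sB.
by rewrite in_between.
Qed.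

Lemma bond_eval_rel u v : bb_rel u v ->
  all (bb_letter n) u -> all (bb_letter n) v ->
  \prod_(l <- u) bond_eval l = \prod_(l <- v) bond_eval l.
Proof.
(* Relations with overpass letters only, where [bond_eval] agrees with [f]. *)
have same_sigma a b : reduced_rel a b -> all (bb_letter n) a ->
    all (bb_letter n) b -> all overpass a -> all overpass b ->
    \prod_(l <- a) bond_eval l = \prod_(l <- b) bond_eval l.
  move=> ab aP bP aO bO.
  have red w : all (bb_letter n) w -> all overpass w -> all (reduced_letter n) w.
    by move=> /allP wP /allP wO; apply/allP => l lw; apply/andP; auto.
  have {}aP := red _ aP aO; have {}bP := red _ bP bO.
  rewrite (eq_big_seq f) => [|l /(allP aP)/bond_eval_reduced //].
  rewrite (f_rel ab) //; apply: eq_big_seq => l /(allP bP).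
  by move=> /bond_eval_reduced.
have lenE i j : i < j -> exists d, j = i + d.+1.
  by move=> ij; exists (j - i.+1); lia.
case.
- by move=> i ? ?; apply: same_sigma => //; constructor.
- by move=> i ? ?; apply: same_sigma => //; constructor.
- by move=> i j ij ? ?; apply: same_sigma => //; constructor.
- by move=> i ? ?; apply: same_sigma => //; constructor.
- move=> i j r s I R /lenE[d ->] jr /lenE[d' ->] _ _.
  rewrite !big_cons big_nil !mulg1 !bond_evalE.
  exact: bond_far_commute.
- move=> i j r s I R ir /lenE[d' ->] sj IR.
  have /lenE[d jE] : i < j by lia.
  rewrite {j}jE in sj *.
  rewrite /= andbT => /andP[/and4P[i0 _ idn _] _] _.
  rewrite !big_cons big_nil !mulg1 !bond_evalE.
  (* Here [e] tells whether the outer bond passes under both end strands of the inner one; either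
     inclusion then reads [C k = e -> B k = e]. *)
  case: IR => [[rI sI RI]|[rI sI RI]].
    apply: (@bond_nested_commute true) => //; try lia.
    move=> k rk kR; have := fsubsetP RI k kR.
    by rewrite inE => /andP[].
  apply: (@bond_nested_commute false) => //; rewrite ?(negPf rI) ?(negPf sI) //; try lia.
  move=> k rk kR; apply: contraFF kR => kI; apply: (fsubsetP RI).
  by rewrite inE kI in_between; lia.
(* Lengthening at the left end is the recursion defining [bond]; at the right end it is
   [conj_bond_right]. *)
- move=> i j I ij sI _ _; rewrite !big_cons big_nil !mulg1 mulgA.
  have [d jE] := lenE _ _ ij; rewrite {1}jE bond_evalE.
  have -> : j = i + d.+2 by lia.
  by rewrite bond_evalE /= (notin_sub_between sI) // ltnn.
- move=> i j I ij sI _ _; rewrite !big_cons big_nil !mulg1 mulgA.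
  have [d jE] := lenE _ _ ij; rewrite {1}jE bond_evalE.
  have -> : j = i + d.+2 by lia.
  rewrite bond_evalE /= !inE eqxx; congr (conj true i _).
  by apply: eq_bond => k ik; rewrite !inE gtn_eqF //; lia.
- move=> i j I ij sI _; rewrite /= andbT => /and4P[i0 _ jn _].
  have /lenE[d jE] : i < j.-1 by lia.
  have {}jE : j = i + d.+2 by lia.
  subst j; rewrite !addnS /= -addnS in sI *.
  rewrite !big_cons big_nil !mulg1 mulgA -[in RHS]addnS !bond_evalE.
  rewrite -conj_bond_right //; last by lia.
  by rewrite (notin_sub_between sI) // ltnn andbF.
- move=> i j I ij sI _; rewrite /= andbT => /and4P[i0 _ jn _].
  have /lenE[d jE] : i < j.-1 by lia.
  have {}jE : j = i + d.+2 by lia.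
  subst j; rewrite !addnS /= -addnS in sI *.
  rewrite !big_cons big_nil !mulg1 mulgA -[in RHS]addnS !bond_evalE.
  rewrite -conj_bond_right //; last by lia.
  rewrite !inE eqxx /=; congr (conj false _ _).
  by apply: eq_bond => k ik; rewrite !inE ltn_eqF //; lia.
- by move=> i ? ?; apply: same_sigma => //=; try constructor; rewrite ?eqxx.
- move=> i r s R irs; rewrite /= andbT => /andP[_ /and4P[r0 /lenE[d sE] sn _]] _.
  subst s; rewrite !big_cons big_nil !mulg1 bond_evalE.
  by apply/esym/(@conj_eqP false); apply: conj_bond_far.
- move=> i r s R ri is_ iR; rewrite /= andbT => /andP[_ /and4P[r0 /lenE[d sE] sn _]] _.
  subst s; rewrite !big_cons big_nil !mulg1 bond_evalE.
  by apply/esym/(@conj_eqP false); apply: conj_bond_swap => //; lia.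
- move=> i r s R R' ri is_ [iR i1R iR' i1R' RR'].
  rewrite /= andbT => /andP[_ /and4P[r0 /lenE[d sE] sn _]] _.
  subst s; rewrite !big_cons big_nil !mulg1 !bond_evalE.
  by apply/esym/(@conj_eqP false); apply: conj_bond_swap => //; lia.
- by move=> i ? ?; apply: same_sigma => //=; try constructor; rewrite ?eqxx.
- by move=> i ? ?; apply: same_sigma => //=; try constructor; rewrite ?eqxx.
Qed.

End ReducedRelations.

(** * Comparison with the relations of BB_n *)

Lemma reduced_rel_bb u v : reduced_rel u v -> bb_rel u v.
Proof.
case; try by constructor.
- move=> i j r s /orP[/and3P[ij jr rs]|/and3P[ir rs sj]]; first exact: bb_3.
  by apply: bb_4 => //; right; rewrite !in_fset0 fset0I fsub0set.
- by move=> i j ij; apply: bb_5_3; [lia|apply: fsub0set].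
- move=> i r s; rewrite !inE => irs.
  (* σ_i lies to the left of the bond, to its right, or strictly inside it. *)
  have [ri|ir] := ltnP r i; last by apply: bb_7; lia.
  have [si|is_] := ltnP s i; first by apply: bb_7; rewrite si orbT.
  by apply: bb_8_1; [lia|lia|right; rewrite !in_fset0].
Qed.

Lemma bond_morph (M N : monoidType) (phi : UMagmaMorphism.type M N)
    (f : letter -> M) (g : letter -> N) B d i :
    (forall l, overpass l -> phi (f l) = g l) ->
  phi (bond f B d i) = bond g B d i.
Proof.
move=> fg; have sgE e j : phi (sg f e j) = sg g e j by case: e; apply: fg.
elim: d i => [|d ih] i /=; first exact/fg/eqxx.
by rewrite /conj !gmulfM !sgE ih.
Qed.

(** Relations 5.1 and 5.2, applied repeatedly at the left end, already express every bond of BB_n by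
    an elementary one; this eliminates the bonds with underpasses. *)
Lemma bond_eval_bb n (N : monoidType) (g : letter -> N) :
    (forall u v, bb_rel u v -> all (bb_letter n) u -> all (bb_letter n) v ->
       \prod_(l <- u) g l = \prod_(l <- v) g l) ->
  forall l, bb_letter n l -> bond_eval g l = g l.
Proof.
move=> g_rel [//|//|i j B] /and4P[i0 ij jn sB].
have [d jE] : exists d, j = i + d.+1 by exists (j - i.+1); lia.
subst j; rewrite bond_evalE {ij}.
elim: d i B i0 jn sB => [|d ih] i B i0 jn sB.
  rewrite /= addn1 in sB *; congr (g (Bond _ _ _)); apply/esym/eqP.
  rewrite -fsubset0; apply/fsubsetP => k /(fsubsetP sB).
  by rewrite in_between; lia.
(* The shortened bond starts at strand i+1, so that strand leaves the underpass set. *)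
pose B1 := (B `\ i.+1)%fset.
have sB1 : (B1 `<=` between i.+1 (i + d.+2))%fset.
  apply/fsubsetP => k; rewrite in_between in_fsetD1 => /andP[ki /(fsubsetP sB)].
  by rewrite in_between; lia.
have -> : bond g (fun k => k \in B) d.+1 i =
    conj g (i.+1 \in B) i (g (Bond i.+1 (i + d.+2) B1)).
  rewrite /= -addSnnS in sB1 *; rewrite -ih //; last by lia.
  congr conj; apply: eq_bond => k ik.
  by rewrite !inE gtn_eqF //; lia.
have ij : i.+1 < i + d.+2 by lia.
have [iB|iNB] := boolP (i.+1 \in B).
  have := g_rel _ _ (bb_5_2 ij sB1).
  rewrite /= fsetD1K // sB sB1 !big_cons big_nil !mulg1 mulgA.
  by apply; lia.
have B1E : B1 = B by apply/mem_fsetD1.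
have := g_rel _ _ (bb_5_1 ij sB1).
rewrite B1E in sB1 *; rewrite /=.
rewrite sB sB1 !big_cons big_nil !mulg1 mulgA.
by apply; lia.
Qed.

(** * Evaluation of unrestricted letters in a presented monoid *)

Section Generators.
Context (P : pred letter) (rel : seq letter -> seq letter -> Prop).

Notation gens := (@on_gens P rel).

(** The default 1 gives a total map on letters, as the hypothesis [f_junk] demands. *)
Definition gen_class (l : letter) : presented_monoid gens :=
  if insub l is Some x then pm_gen gens x else 1.

Lemma gen_class_val (x : {l : letter | P l}) :
  gen_class (val x) = pm_gen gens x.
Proof. by rewrite /gen_class valK. Qed.

Lemma gen_class_rel u v : rel u v -> all P u -> all P v ->
  \prod_(l <- u) gen_class l = \prod_(l <- v) gen_class l.
Proof.
have lift w : all P w -> exists w' : seq {l : letter | P l}, w = map val w'.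
  elim: w => [|l w ih] /=; first by exists [::].
  by move=> /andP[lP /ih[w' ->]]; exists (exist _ l lP :: w').
move=> uv /lift[u' uE] /lift[v' vE]; subst u v.
have valE w : \prod_(l <- map val w) gen_class l = word_class gens w.
  by rewrite big_map word_class_prod; apply: eq_bigr => x _; exact: gen_class_val.
rewrite !valE; apply/word_classP.
by rewrite -(cats0 u') -(cats0 v'); apply: (@cong_rel _ _ _ _ [::] [::]).
Qed.

End Generators.

(** * The two mutually inverse morphisms *)

Theorem theorem3p7 (n : nat) :
  has_presentation (@reduced_elt n) (@on_gens (reduced_letter n) reduced_rel).
Proof.
pose f := @gen_class (reduced_letter n) reduced_rel.
pose g := @gen_class (bb_letter n) bb_rel.
have f_rel := @gen_class_rel (reduced_letter n) reduced_rel.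
have g_rel := @gen_class_rel (bb_letter n) bb_rel.
have f_junk l : ~~ reduced_letter n l -> f l = 1.
  by move=> lNP; rewrite /f /gen_class insubN.
have elt_val x : reduced_elt x = g (val x).
  by rewrite -[val x]/(val (reduced_to_bb x)) /g gen_class_val.
have all_val (P : pred letter) (w : seq {l : letter | P l}) : all P (map val w).
  by apply/allP => _ /mapP[x _ ->]; exact: valP.
have [phi phiE] : exists phi : UMagmaMorphism.type _ (BB n),
    forall x, phi (pm_gen (@on_gens (reduced_letter n) reduced_rel) x) =
      reduced_elt x.
  apply: presented_monoid_lift => u v uv.
  have bbP (w : seq (reduced_gen n)) : all (bb_letter n) (map val w).
    by apply: sub_all (all_val _ w) => l /reduced_letter_bb.
  have valE w : \prod_(x <- w) reduced_elt x = \prod_(l <- map val w) g l.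
    by rewrite big_map; apply: eq_bigr.
  by rewrite !valE; apply: g_rel; [exact: reduced_rel_bb|exact: bbP|exact: bbP].
(* The inverse sends each bond to its conjugate expression in the reduced monoid. *)
have [psi psiE] : exists psi : UMagmaMorphism.type (BB n) _,
    forall x, psi (pm_gen (@on_gens (bb_letter n) bb_rel) x) =
      bond_eval f (val x).
  apply: presented_monoid_lift => u v uv.
  rewrite -!(big_map val xpredT (bond_eval f)).
  by apply: (bond_eval_rel f_rel f_junk uv); exact: all_val.
exists phi; split=> //; exists psi.
  apply: (@presented_monoid_ext _ _ _ (psi \o phi) idfun) => x /=.
  rewrite phiE psiE /= (bond_eval_reduced f_rel) ?(valP x) //.
  exact: gen_class_val.
apply: (@presented_monoid_ext _ _ _ (phi \o psi) idfun) => x /=.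
(* For an overpass letter that is not a generator, both sides take the default value 1. *)
have phi_f l : overpass l -> phi (f l) = g l.
  move=> lO; rewrite /f /g /gen_class.
  case: insubP => [y _ <-|]; first by rewrite phiE elt_val /g /gen_class.
  rewrite /reduced_letter lO andbT => lNP.
  by rewrite insubN // gmulf1.
have -> : phi (psi (pm_gen _ x)) = bond_eval g (val x).
  rewrite psiE; case: (val x) => [i|i|i j B]; [exact: phi_f|exact: phi_f|].
  exact: bond_morph phi_f.
rewrite (bond_eval_bb g_rel) ?(valP x) //.
exact: gen_class_val.
Qed.
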